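(* The triple $(\mathcal{V},[\cdot,\cdot]_0,\widehat{\triangleright})$ is a post-Lie algebra.
   Context: Here $\mathbb{N}=\{0,1,2,\dots\}$, $d\ge 0$ is fixed, and $e_0,\dots,e_d$ is the canonical basis of $\mathbb{N}^{d+1}$. For $k,\ell\in\mathbb{N}^{d+1}$, $\binom{k}{\ell}=\prod_i\binom{k_i}{\ell_i}$. Post-Lie algebra. A post-Lie algebra is a Lie algebra $(\mathfrak{g},[\cdot,\cdot])$ with a bilinear product $\triangleright$ such that for all $x,y,z\in\mathfrak g$: $x\triangleright[y,z]=[x\triangleright y,z]+[y,x\triangleright z]$ and $[x,y]\triangleright z=a_\triangleright(x,y,z)-a_\triangleright(y,x,z)$, where $a_\triangleright(x,y,z)=x\triangleright(y\triangleright z)-(x\triangleright y)\triangleright z$. Decorated trees. A decorated tree is a finite non-planar rooted tree (up to isomorphism) with a node decoration $\mathfrak{n}_v\in\mathbb{N}^{d+1}$ at each node $v$ and an edge decoration on each edge, which is either $(I,a)$ with $a\in\mathbb{N}^{d+1}$, or $(\Xi,0)$ (a noise edge). Noise edges are terminal, and their leaf has node decoration $0$; nothing may be grafted onto, and no decoration inserted at, the leaf of a noise edge. Accordingly $N_\tau$ denotes the set of nodes of $\tau$ other than leaves of noise edges. $\mathfrak{T}$ is the set of decorated trees. All operations are extended (bi)linearly. $I_a(\tau)$ is the planted tree obtained by joining the root of $\tau$ to a new root of decoration $0$ by an edge decorated $(I,a)$; $I_a(\tau)=0$ if $a\notin\mathbb{N}^{d+1}$. Operations. For $v\in N_\tau$,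 $k\in\mathbb{Z}^{d+1}$, $\uparrow_v^{k}\tau$ adds $k$ to the decoration of $v$ (and is $0$ if the result is not in $\mathbb{N}^{d+1}$). $\sigma\curvearrowright^{a}_v\tau$ joins the root of $\sigma$ to the node $v$ of $\tau$ by a new edge decorated $(I,a)$ (and is $0$ if $a\notin\mathbb{N}^{d+1}$). The deformed grafting is $\sigma\,\widehat{\curvearrowright}^{a}\,\tau=\sum_{v\in N_\tau}\sum_{\ell\in\mathbb{N}^{d+1}}\binom{\mathfrak{n}_v}{\ell}\,\sigma\curvearrowright_v^{a-\ell}(\uparrow_v^{-\ell}\tau)$, and on planted trees $I_a(\sigma)\,\widehat{\curvearrowright}\,I_b(\tau)=I_b(\sigma\,\widehat{\curvearrowright}^{a}\,\tau)$. Also $\uparrow^i\tau=\sum_{v\in N_\tau}\uparrow_v^{e_i}\tau$, and on planted trees $\uparrow^i I_a(\tau)=I_a(\uparrow^i\tau)$ (the root of a planted tree keeps decoration $0$). The space. $\mathcal V$ is the real vector space with basis $\{I_a(\tau):a\in\mathbb{N}^{d+1},\tau\in\mathfrak T\}\cup\{X_0,\dots,X_d\}$, with the $X_i$ formal symbols, and $\tilde{\mathcal V}$ is the span of the $I_a(\tau)$. The product $\widehat{\triangleright}$ on $\mathcal V$ is the bilinear map with $$X_i\,\widehat{\triangleright}\,I_a(\tau)=\uparrow^iI_a(\tau),\quad I_a(\tau)\,\widehat{\triangleright}\,X_i=0,\quad X_i\,\widehat{\triangleright}\,X_j=0,\quad I_a(\sigma)\,\widehat{\triangleright}\,I_b(\tau)=I_a(\sigma)\,\widehat{\curvearrowright}\,I_b(\tau).$$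 The bracket $[\cdot,\cdot]_0$ is the antisymmetric bilinear map which vanishes on $\tilde{\mathcal V}\times\tilde{\mathcal V}$ and on pairs from the span of the $X_i$, and $[I_a(\tau),X_i]_0=I_{a-e_i}(\tau)$. *)

(* Defs.v *)
From HB Require Import structures.
From mathcomp Require Import all_boot all_algebra perm sesquilinear.
From mathcomp Require Import generic_quotient.
From mathcomp Require Import boolp classical_sets fsbigop reals.
From mathcomp Require Import freeg.

Set Implicit Arguments.
Unset Strict Implicit.
Unset Printing Implicit Defensive.

Import GRing.Theory Num.Theory.

Local Open Scope ring_scope.
Local Open Scope quotient_scope.

Section PostLie.
Variables (K : nzRingType) (g : lmodType K).
Implicit Types br tri : g -> g -> g.

Record is_lie br : Prop := IsLie {
  lie_bilinear : bilinear_for *:%R *:%R br;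
  lie_alternating : forall x, br x x = 0;
  lie_jacobi :
    forall x y z, br x (br y z) + br y (br z x) + br z (br x y) = 0 }.

Definition associator tri (x y z : g) : g := tri x (tri y z) - tri (tri x y) z.

Record is_post_lie br tri : Prop := IsPostLie {
  post_lie_lie : is_lie br;
  post_lie_bilinear : bilinear_for *:%R *:%R tri;
  post_lie_derivation :
    forall x y z, tri x (br y z) = br (tri x y) z + br y (tri x z);
  post_lie_associator :
    forall x y z, tri (br x y) z = associator tri x y z - associator tri y x z }.

End PostLie.

Definition multi (d : nat) := {ffun 'I_d.+1 -> nat}.
Definition zmulti (d : nat) := {ffun 'I_d.+1 -> int}.

Section Multi.
Variable d : nat.

Definition multi0 : multi d := [ffun => 0%N].

Definition to_zmulti (k : multi d) : zmulti d := [ffun i => (k i)%:Z].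

(* None stands for "not in N^(d+1)". *)
Definition of_zmulti (z : zmulti d) : option (multi d) :=
  if [forall i, 0 <= z i] then Some [ffun i => `|z i|%N] else None.

Definition basis_multi (i : 'I_d.+1) : zmulti d := [ffun j => (j == i)%:Z].

Definition multi_bin (k l : multi d) : nat := (\prod_(i < d.+1) 'C(k i, l i))%N.

End Multi.

(* Planar representatives: [PNode n m f] has a root decorated by n, with m
   noise edges (Xi, 0) attached to it and, for each (a, t) in f, an edge
   decorated (I, a) leading to the root of t.  A noise edge carries no further
   data (it ends in a leaf of decoration 0 on which nothing acts), so only the
   number of them at each node is recorded, and the [PNode]s of a tree are
   exactly the elements of its set N_tau. *)
Inductive ptree (d : nat) : Type :=
  PNode of multi d & nat & seq (multi d * ptree d).

HB.instance Definition _ d := gen_eqMixin (ptree d).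
HB.instance Definition _ d := gen_choiceMixin (ptree d).

(* Two planar trees are isomorphic iff they represent the same non-planar tree. *)
Inductive iso (d : nat) : ptree d -> ptree d -> Prop :=
  Iso n m k (f g : k.-tuple (multi d * ptree d)) (s : 'S_k) :
    (forall i, (tnth f i).1 = (tnth g (s i)).1) ->
    (forall i, iso (tnth f i).2 (tnth g (s i)).2) ->
    iso (PNode n m f) (PNode n m g).

Section Iso.
Variable d : nat.

Lemma ptree_nested_ind (P : ptree d -> Prop) :
  (forall n m f, (forall i, (i < size f)%N ->
     P (nth (multi0 d, PNode (multi0 d) 0 [::]) f i).2) -> P (PNode n m f)) ->
  forall t, P t.
Proof.
move=> IH; fix rec 1 => -[n m f]; apply: IH.
elim: f => [i i_lt|[a t] f IHf [_|i]]; first by discriminate i_lt.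
  exact: rec.
exact: IHf.
Qed.

Lemma iso_refl (t : ptree d) : iso t t.
Proof.
elim/ptree_nested_ind: t => n m f IH.
apply: (@Iso _ n m _ (in_tuple f) (in_tuple f) 1%g) => i; rewrite perm1 //.
by rewrite (tnth_nth (multi0 d, PNode (multi0 d) 0 [::])); apply: IH.
Qed.

Lemma iso_sym (t u : ptree d) : iso t u -> iso u t.
Proof.
elim=> n m k f g s ha _ IH; apply: (@Iso _ n m k g f s^-1%g) => i.
  by rewrite ha permKV.
by have := IH (s^-1%g i); rewrite permKV.
Qed.

Lemma iso_trans (t u w : ptree d) : iso t u -> iso u w -> iso t w.
Proof.
move=> tu; elim: tu w => {t u} n m k f g s ha _ IH w guw.
move: {-2}(PNode _ _ g) guw (erefl (PNode n m g)) => u guw.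
case: guw => n' m' k' f' g' s' ha' hi' [<- <- fg].
have kk : k' = k by rewrite -(size_tuple f') -(size_tuple g) fg.
subst k'; have {fg} ? : f' = g by apply: val_inj.
subst f'; apply: (@Iso _ _ _ _ _ _ (s * s')%g) => i; rewrite permM.
  by rewrite ha.
exact: IH.
Qed.

Definition iso_rel (t u : ptree d) : bool := `[< iso t u >].

Lemma iso_rel_refl : reflexive iso_rel.
Proof. by move=> t; apply/asboolP; exact: iso_refl. Qed.

Lemma iso_rel_sym : symmetric iso_rel.
Proof. by move=> t u; apply/asboolP/asboolP; exact: iso_sym. Qed.

Lemma iso_rel_trans : transitive iso_rel.
Proof.
by move=> u t w /asboolP tu /asboolP uw; apply/asboolP; exact: iso_trans tu uw.
Qed.

Canonical iso_equiv := EquivRel iso_rel iso_rel_refl iso_rel_sym iso_rel_trans.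

Definition dtree := {eq_quot iso_rel}.
HB.instance Definition _ := Choice.on dtree.
HB.instance Definition _ := EqQuotient.on dtree.

End Iso.

Section PlanarOperations.
Variable d : nat.
Implicit Types (t : ptree d) (v : seq nat).

(* Default value for [nth], never reached at a valid address. *)
Let b0 : multi d * ptree d := (multi0 d, PNode (multi0 d) 0 [::]).

(* The address [::] is the root; i :: v is the address v in the i-th child. *)
Fixpoint nodes t : seq (seq nat) :=
  let: PNode _ _ f := t in
  let addrs := [seq nodes b.2 | b <- f] in
  [::] :: flatten [seq [seq i :: v | v <- nth [::] addrs i]
                  | i <- iota 0 (size f)].

Fixpoint subtree t v : ptree d :=
  if v is i :: v' then let: PNode _ _ f := t in subtree (nth b0 f i).2 v'
  else t.

Fixpoint map_at (h : ptree d -> ptree d) t v : ptree d :=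
  if v is i :: v' then
    let: PNode n m f := t in let b := nth b0 f i in
    PNode n m (set_nth b0 f i (b.1, map_at h b.2 v'))
  else h t.

Definition node_dec t v : multi d := let: PNode n _ _ := subtree t v in n.

(* None stands for the result 0 of an operation. *)
Definition raise_at (v : seq nat) (k : zmulti d) t : option (ptree d) :=
  omap (fun n' => map_at (fun u => let: PNode _ m f := u in PNode n' m f) t v)
       (of_zmulti (to_zmulti (node_dec t v) + k)).

Definition graft_at (s : ptree d) (a : zmulti d) (v : seq nat) t :
    option (ptree d) :=
  omap (fun a' =>
          map_at (fun u => let: PNode n m f := u in PNode n m ((a', s) :: f))
                 t v)
       (of_zmulti a).

End PlanarOperations.

(* [Planted a t] stands for the planted tree I_a(t). *)
Inductive genV (d : nat) : Type :=
  | Planted of multi d & dtree d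
  | Xsymb of 'I_d.+1.

HB.instance Definition _ d := gen_eqMixin (genV d).
HB.instance Definition _ d := gen_choiceMixin (genV d).

Section Space.
Variables (R : realType) (d : nat).

Definition treeV : lmodType R := {freeg (dtree d) / R}.
Definition V : lmodType R := {freeg (genV d) / R}.

Definition bilinear_ext (op : genV d -> genV d -> V) (x y : V) : V :=
  fglift (fun b => fglift (op b) y) x.

(* The class of a planar tree, with None sent to 0. *)
Definition tree_class (o : option (ptree d)) : treeV :=
  if o is Some t then << \pi_(dtree d) t >> else 0.

(* The operations on (non-planar) trees are computed on representatives; the
   results depend only on the isomorphism classes.  The sum over l has finite
   support since the binomial coefficient vanishes unless l <= n_v. *)
Definition deformed_graft (a : multi d) (s t : dtree d) : treeV :=
  \sum_(v <- nodes (repr t)) \sum_(l \in [set: multi d])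
    (multi_bin (node_dec (repr t) v) l)%:R *:
      tree_class (obind (graft_at (repr s) (to_zmulti a - to_zmulti l) v)
                      (raise_at v (- to_zmulti l) (repr t))).

Definition raise (i : 'I_d.+1) (t : dtree d) : treeV :=
  \sum_(v <- nodes (repr t)) tree_class (raise_at v (basis_multi i) (repr t)).

(* I_a for a in Z^(d+1), with the convention I_a = 0 outside N^(d+1). *)
Definition plantz (a : zmulti d) (t : dtree d) : V :=
  if of_zmulti a is Some a' then << Planted a' t >> else 0.

Definition plant (a : multi d) (x : treeV) : V := fglift (plantz (to_zmulti a)) x.

Definition triangle_basis (x y : genV d) : V :=
  match x, y with
  | Xsymb i, Planted a t => plant a (raise i t)
  | Planted a s, Planted b t => plant b (deformed_graft a s t)
  | _, Xsymb _ => 0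
  end.

Definition bracket0_basis (x y : genV d) : V :=
  match x, y with
  | Planted a t, Xsymb i => plantz (to_zmulti a - basis_multi i) t
  | Xsymb i, Planted a t => - plantz (to_zmulti a - basis_multi i) t
  | _, _ => 0
  end.

Definition deformed_triangle : V -> V -> V := bilinear_ext triangle_basis.
Definition bracket0 : V -> V -> V := bilinear_ext bracket0_basis.

End Space.

(* Main.v *)
From HB Require Import structures.
Require Import Defs.
From mathcomp Require Import all_boot all_algebra reals.
From mathcomp Require Import perm sesquilinear generic_quotient.
From mathcomp Require Import boolp classical_sets fsbigop freeg.

Set Implicit Arguments.
Unset Strict Implicit.
Unset Printing Implicit Defensive.

Import GRing.Theory Num.Theory.

Local Open Scope ring_scope.
Local Open Scope quotient_scope.

(** Grafting, deformed or not, and raising a decoration all have the same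
    shape: at each node in turn, change the decoration and attach new branches,
    by a rule that sees only the decoration of that node.  Call such a rule a
    local operator [L], and let [everywhere L] be the sum of its applications
    over all nodes of a tree.  Applying [L] and then [L'] in this way gives
    three kinds of terms: both rules act at the same node ([then_op]), [L'] acts
    inside a branch that [L] has just attached ([in_new]), or they act at two
    different nodes of the original tree.  The last kind is symmetric in [L] and
    [L'], so the commutator of [everywhere L] and [everywhere L'] is again of
    the form [everywhere], for the difference of the first two kinds
    ([everywhere_bracket]).

    All that is left is arithmetic at a single node.
    - Two raisings commute, because addition of decorations does.
    - Two deformed graftings commute at a node, because the trinomial
      coefficient C(n, l) C(n - l, m) is symmetric in l and m.  Hence only the
      [in_new] terms survive, which is the pre-Lie identity ([graft_graft]).
    - Raising in direction i before or after a deformed grafting compares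
      C(n + e_i, l) with C(n, l).  By Pascal's rule the difference is
      C(n, l - e_i), and the shift of l by e_i turns it into a grafting along
      an edge of decoration a - e_i: this is the bracket of the planted tree with
      X_i ([raise_graft]).

    With a planted tree as last argument, these three identities are the
    associator axiom on the basis; with X_i as last argument, the axiom is
    trivial since all products with X_i on the right vanish.  The Jacobi
    identity and the derivation axiom only say that the shifts
    of the decoration of the trunk commute with each other and with whatever
    happens above the trunk.

    The computation takes place on planar trees.  A linear combination is a list
    of weighted terms, and it is only ever seen through the sum [ev phi] of the
    values of a function [phi] on its terms.  For [phi] invariant under
    isomorphism, this descends to non-planar trees ([ev_everywhere_iso],
    [graft_op_iso]). *)

(** * Formal linear combinations *)
Section Comb.
Variables (R : comNzRingType) (M : lmodType R).

Definition comb (T : Type) := seq (R * T).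

Definition ev T (phi : T -> M) (c : comb T) : M := \sum_(x <- c) x.1 *: phi x.2.

(** [cmap], [cscale] and [cbind] make [comb] a linear version of the list monad;
    [ev] turns them into composition, scaling and iterated summation. *)
Definition cmap T U (h : T -> U) (c : comb T) : comb U :=
  [seq (x.1, h x.2) | x <- c].

Definition cscale T (k : R) (c : comb T) : comb T := [seq (k * x.1, x.2) | x <- c].

Definition cbind T U (c : comb T) (h : T -> comb U) : comb U :=
  flatten [seq cscale x.1 (h x.2) | x <- c].

Lemma ev_nil T (phi : T -> M) : ev phi [::] = 0.
Proof. exact: big_nil. Qed.

Lemma ev_cons T (phi : T -> M) x c : ev phi (x :: c) = x.1 *: phi x.2 + ev phi c.
Proof. exact: big_cons. Qed.

Lemma ev_seq1 T (phi : T -> M) x : ev phi [:: (1, x)] = phi x.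
Proof. by rewrite ev_cons ev_nil addr0 scale1r. Qed.

Lemma ev_cat T (phi : T -> M) c e : ev phi (c ++ e) = ev phi c + ev phi e.
Proof. exact: big_cat. Qed.

Lemma ev_map T U (phi : U -> M) (h : T -> U) c :
  ev phi (cmap h c) = ev (fun x => phi (h x)) c.
Proof. exact: big_map. Qed.

Lemma ev_scale T (phi : T -> M) k c : ev phi (cscale k c) = k *: ev phi c.
Proof.
by rewrite /ev big_map scaler_sumr; apply: eq_bigr => x _; rewrite scalerA.
Qed.

Lemma ev_bind T U (phi : U -> M) c (h : T -> comb U) :
  ev phi (cbind c h) = ev (fun x => ev phi (h x)) c.
Proof.
elim: c => [|x c IHc]; first by rewrite !ev_nil.
by rewrite /cbind /= ev_cat ev_cons ev_scale -/(cbind c h) IHc.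
Qed.

Lemma eq_ev T (phi psi : T -> M) c : phi =1 psi -> ev phi c = ev psi c.
Proof. by move=> e; apply: eq_bigr => x _; rewrite e. Qed.

Lemma evD T (phi psi : T -> M) c :
  ev (fun x => phi x + psi x) c = ev phi c + ev psi c.
Proof. by rewrite -big_split; apply: eq_bigr => x _; rewrite scalerDr. Qed.

Lemma evZ T (phi : T -> M) k c : ev (fun x => k *: phi x) c = k *: ev phi c.
Proof.
by rewrite scaler_sumr; apply: eq_bigr => x _; rewrite !scalerA mulrC.
Qed.

Lemma ev_sum T I (r : seq I) (phi : I -> T -> M) c :
  ev (fun x => \sum_(i <- r) phi i x) c = \sum_(i <- r) ev (phi i) c.
Proof.
by rewrite exchange_big; apply: eq_bigr => x _; rewrite scaler_sumr.
Qed.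

(** Fubini for finite sums: this is what makes operations on disjoint parts of a
    tree commute. *)
Lemma ev_exchange T U (phi : T -> U -> M) c e :
  ev (fun x => ev (phi x) e) c = ev (fun y => ev (phi^~ y) c) e.
Proof.
rewrite /ev; under eq_bigr => x _ do rewrite scaler_sumr.
rewrite exchange_big; apply: eq_bigr => y _; rewrite scaler_sumr.
by apply: eq_bigr => x _; rewrite !scalerA mulrC.
Qed.

End Comb.

(** * Local operators and their commutators *)
Section LocalOperators.
Variables (R : comNzRingType) (d : nat).
Local Notation tree := (ptree d).
Local Notation forest := (seq (multi d * ptree d)).

(** A local operator sends the decoration of a node to a combination of pairs
    made of the new decoration and the list of branches to attach. *)
Definition local_op := multi d -> comb R (multi d * forest).

(** The inner fixpoint is [everywhere_forest], repeated here because the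
    recursion goes through the list of branches. *)
Fixpoint everywhere (L : local_op) (t : tree) : comb R tree :=
  let: PNode n m f := t in
  cmap (fun x => PNode x.1 m (x.2 ++ f)) (L n) ++
  cmap (PNode n m)
    ((fix go f := if f is (a, u) :: f' then
        cmap (fun u' => (a, u') :: f') (everywhere L u) ++
        cmap (cons (a, u)) (go f')
      else [::]) f).

Fixpoint everywhere_forest (L : local_op) (f : forest) : comb R forest :=
  if f is (a, u) :: f' then
    cmap (fun u' => (a, u') :: f') (everywhere L u) ++
    cmap (cons (a, u)) (everywhere_forest L f')
  else [::].

Lemma everywhereE L n m f : everywhere L (PNode n m f) =
  cmap (fun x => PNode x.1 m (x.2 ++ f)) (L n) ++
  cmap (PNode n m) (everywhere_forest L f).
Proof. by rewrite /=; congr (_ ++ cmap _ _); elim: f => [//|[a u] f /= ->]. Qed.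

(** The part of [L] followed by [L'] in which both act at the same node. *)
Definition then_op (L L' : local_op) : local_op := fun n =>
  cbind (L n) (fun x => cmap (fun y => (y.1, y.2 ++ x.2)) (L' x.1)).

(** The part of [L] followed by [L'] in which [L'] acts inside the branches that
    [L] attaches. *)
Definition in_new (L L' : local_op) : local_op := fun n =>
  cbind (L n) (fun x => cmap (pair x.1) (everywhere_forest L' x.2)).

Definition op_bracket (L L' : local_op) : local_op := fun n =>
  (then_op L L' n ++ in_new L L' n) ++
  cscale (-1) (then_op L' L n ++ in_new L' L n).

Variable M : lmodType R.

Lemma ev_node (phi : tree -> M) L n m f :
  ev phi (everywhere L (PNode n m f)) =
    ev (fun x => phi (PNode x.1 m (x.2 ++ f))) (L n) +
    ev (fun g => phi (PNode n m g)) (everywhere_forest L f).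
Proof. by rewrite everywhereE ev_cat !ev_map. Qed.

Lemma ev_forest_cons (phi : forest -> M) L b f :
  ev phi (everywhere_forest L (b :: f)) =
    ev (fun u => phi ((b.1, u) :: f)) (everywhere L b.2) +
    ev (fun g => phi (b :: g)) (everywhere_forest L f).
Proof. by case: b => a u; rewrite /= ev_cat !ev_map. Qed.

Lemma ev_forest_cat (phi : forest -> M) L f g :
  ev phi (everywhere_forest L (f ++ g)) =
    ev (fun h => phi (h ++ g)) (everywhere_forest L f) +
    ev (fun h => phi (f ++ h)) (everywhere_forest L g).
Proof.
elim: f phi => [|b f IHf] phi; first by rewrite ev_nil add0r.
by rewrite cat_cons !ev_forest_cons IHf addrA.
Qed.

(** After [L] has been applied somewhere in the tree, [L'] can act at the root, in
    the branches attached by [L], or in the original ones.  The second and third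
    summands, where exactly one of the two operators acts at the root, are
    exchanged by swapping [L] and [L']. *)
Lemma ev_node2 (phi : tree -> M) L L' n m f :
  ev (fun u => ev phi (everywhere L' u)) (everywhere L (PNode n m f)) =
    ev (fun x => phi (PNode x.1 m (x.2 ++ f))) (then_op L L' n ++ in_new L L' n)
  + ev (fun x => ev (fun g => phi (PNode x.1 m (x.2 ++ g)))
                   (everywhere_forest L' f)) (L n)
  + ev (fun x => ev (fun g => phi (PNode x.1 m (x.2 ++ g)))
                   (everywhere_forest L f)) (L' n)
  + ev (fun g => ev (fun h => phi (PNode n m h)) (everywhere_forest L' g))
      (everywhere_forest L f).
Proof.
rewrite ev_node.
under eq_ev => x do rewrite ev_node ev_forest_cat.
under [X in _ + X = _]eq_ev => x do rewrite ev_node.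
rewrite !evD ev_cat !ev_bind [X in _ + (X + _)]ev_exchange !addrA.
congr (_ + _ + _ + _ + _).
  by apply: eq_ev => x; rewrite ev_map; apply: eq_ev => y; rewrite catA.
by apply: eq_ev => x; rewrite ev_map.
Qed.

(** The two middle summands, where one operator acts in the first branch and the
    other in a later one, are exchanged by swapping [L] and [L']. *)
Lemma ev_forest_cons2 (phi : forest -> M) L L' b f :
  ev (fun u => ev phi (everywhere_forest L' u)) (everywhere_forest L (b :: f)) =
    ev (fun u => ev (fun u' => phi ((b.1, u') :: f)) (everywhere L' u))
      (everywhere L b.2)
  + ev (fun u => ev (fun g => phi ((b.1, u) :: g)) (everywhere_forest L' f))
      (everywhere L b.2)
  + ev (fun u => ev (fun g => phi ((b.1, u) :: g)) (everywhere_forest L f))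
      (everywhere L' b.2)
  + ev (fun g => ev (fun h => phi (b :: h)) (everywhere_forest L' g))
      (everywhere_forest L f).
Proof.
rewrite ev_forest_cons.
under eq_ev => x do rewrite ev_forest_cons.
under [X in _ + X = _]eq_ev => x do rewrite ev_forest_cons.
by rewrite !evD [X in _ + (X + _)]ev_exchange !addrA.
Qed.

Lemma cancel_cross (A : zmodType) (a b x y p q : A) :
  (a + x + y + p) - (b + y + x + q) = (a - b) + (p - q).
Proof.
rewrite -(addrA a x y) -(addrA b y x) (addrC y x) (addrAC a) (addrAC b).
by rewrite [in LHS]opprD [LHS]addrACA subrr addr0 opprD addrACA.
Qed.

(** Commutators of sums over all nodes are sums over all nodes.  By induction on
    the tree: the mixed terms of [ev_node2] and [ev_forest_cons2] cancel, leaving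
    the terms where both operators act at the root and those where both act
    inside one branch. *)
Lemma everywhere_bracket (phi : tree -> M) L L' t :
  ev (fun u => ev phi (everywhere L' u)) (everywhere L t)
  - ev (fun u => ev phi (everywhere L u)) (everywhere L' t)
  = ev phi (everywhere (op_bracket L L') t).
Proof.
elim/ptree_nested_ind: t phi => n m f IHf phi.
rewrite !ev_node2 ev_node cancel_cross; congr (_ + _).
  by rewrite [RHS]ev_cat ev_scale scaleN1r.
move: (fun g => phi (PNode n m g)) => {}phi.
elim: f IHf phi => [|b f IH] IHf phi; first by rewrite !ev_nil subrr.
rewrite !ev_forest_cons2 cancel_cross ev_forest_cons; congr (_ + _).
  exact: (IHf 0%N).
by apply: IH => i; apply: (IHf i.+1).
Qed.

End LocalOperators.

(** * Sums over addresses of nodes *)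
Definition branch0 d : multi d * ptree d := (multi0 d, PNode (multi0 d) 0 [::]).

Section Addresses.
Variables (R : comNzRingType) (d : nat) (M : lmodType R).
Local Notation tree := (ptree d).
Local Notation forest := (seq (multi d * ptree d)).
Local Notation b0 := (branch0 d).

Definition modify_root (x : multi d * forest) (t : tree) : tree :=
  let: PNode _ m f := t in PNode x.1 m (x.2 ++ f).

Lemma ev_forest_nth (psi : forest -> M) L f :
  ev psi (everywhere_forest L f) =
  \sum_(i < size f)
    ev (fun u => psi (set_nth b0 f i ((nth b0 f i).1, u)))
       (everywhere L (nth b0 f i).2).
Proof.
elim: f psi => [|b f IHf] psi; first by rewrite big_ord0 ev_nil.
by rewrite ev_forest_cons big_ord_recl IHf.
Qed.

(** The recursive description of [everywhere] serves the commutator formula; this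
    one, a sum over addresses, compares it with the operations on decorated
    trees, and shows that [everywhere L] is linear in [L]. *)
Lemma ev_everywhere_nodes (phi : tree -> M) L t :
  ev phi (everywhere L t) =
  \sum_(v <- nodes t)
    ev (fun x => phi (map_at (modify_root x) t v)) (L (node_dec t v)).
Proof.
elim/ptree_nested_ind: t phi => n m f IHf phi.
rewrite ev_node ev_forest_nth /= big_cons; congr (_ + _).
rewrite big_flatten big_map -(big_mkord xpredT (fun i =>
  ev (fun u => phi (PNode n m (set_nth b0 f i ((nth b0 f i).1, u))))
       (everywhere L (nth b0 f i).2))) /index_iota subn0.
apply: eq_big_seq => i; rewrite mem_iota => /= lt_if.
by rewrite big_map (nth_map b0) // IHf.
Qed.

End Addresses.

(** * Invariance under isomorphism *)
Section Isomorphism.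
Variables (R : comNzRingType) (d : nat) (M : lmodType R).
Local Notation tree := (ptree d).
Local Notation forest := (seq (multi d * ptree d)).
Local Notation b0 := (branch0 d).

Lemma iso_nth n m k (f g : forest) (s : 'S_k) : size f = k -> size g = k ->
  (forall i : 'I_k, (nth b0 f i).1 = (nth b0 g (s i)).1) ->
  (forall i : 'I_k, iso (nth b0 f i).2 (nth b0 g (s i)).2) ->
  iso (PNode n m f) (PNode n m g).
Proof.
move=> /eqP sz_f /eqP sz_g ea ei.
apply: (@Iso d n m k (Tuple sz_f) (Tuple sz_g) s) => i.
  by rewrite !(tnth_nth b0) /= ea.
by rewrite !(tnth_nth b0) /=.
Qed.

(** Inversion in terms of [nth], which avoids the dependently typed tuples of the
    definition of [iso]. *)
Lemma iso_inv n m f t' : iso (PNode n m f) t' ->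
  exists g (s : 'S_(size f)), [/\ t' = PNode n m g, size g = size f,
    forall i : 'I_(size f), (nth b0 f i).1 = (nth b0 g (s i)).1 &
    forall i : 'I_(size f), iso (nth b0 f i).2 (nth b0 g (s i)).2].
Proof.
move et: (PNode n m f) => t tt'; case: tt' et => n' m' k f' g s ea ei [-> -> ef].
have sz_f : size f = k by rewrite ef size_tuple.
case: _ / sz_f in f' g s ef ea ei *.
exists (tval g), s; split; rewrite ?size_tuple // => i.
- by move: (ea i); rewrite !(tnth_nth b0) -ef.
- by move: (ei i); rewrite !(tnth_nth b0) -ef.
Qed.

(** A permutation of the old branches extends by the identity to the new ones,
    which are put in front of them. *)
Lemma iso_modify_root (x : multi d * forest) t u :
  iso t u -> iso (modify_root x t) (modify_root x u).
Proof.
case: t => n m f /iso_inv[g [s [-> sz_g ea ei]]] /=.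
case: x => n' h /=; elim: h => [|b h IHh] /=.
  exact: (iso_nth _ _ erefl sz_g ea ei).
case/iso_inv: IHh => g' [s' [[<-] sz ea' ei']].
apply: (@iso_nth _ _ _ _ _ (lift_perm ord0 ord0 s')); rewrite /= ?sz // => i.
  by case: (unliftP ord0 i) => [j|] ->; rewrite ?lift_perm_id ?lift_perm_lift;
    [exact: ea' | by []].
by case: (unliftP ord0 i) => [j|] ->; rewrite ?lift_perm_id ?lift_perm_lift /=;
  [exact: ei' | apply: iso_refl].
Qed.

Lemma iso_set_nth n m (f : forest) i a u w :
  iso u w ->
  iso (PNode n m (set_nth b0 f i (a, u))) (PNode n m (set_nth b0 f i (a, w))).
Proof.
move=> uw; apply: (@iso_nth _ _ _ _ _ 1%g); rewrite ?size_set_nth // => j;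
  rewrite perm1 !nth_set_nth /=; case: eqP => // _; exact: iso_refl.
Qed.

Lemma iso_map_at (h h' : tree -> tree) t v :
  (forall u, iso (h u) (h' u)) -> iso (map_at h t v) (map_at h' t v).
Proof.
move=> hh'; elim: v t => [|i v IHv] [n m f] //=.
by apply: iso_set_nth; apply: IHv.
Qed.

(** Replacing corresponding branches by the same tree keeps the same matching of
    the branches. *)
Lemma iso_set_nth_perm n m (f g : forest) (s : 'S_(size f)) (i : 'I_(size f)) a u :
  size g = size f ->
  (forall i : 'I_(size f), (nth b0 f i).1 = (nth b0 g (s i)).1) ->
  (forall i : 'I_(size f), iso (nth b0 f i).2 (nth b0 g (s i)).2) ->
  iso (PNode n m (set_nth b0 f i (a, u))) (PNode n m (set_nth b0 g (s i) (a, u))).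
Proof.
move=> sz_g ea ei.
have sz h (j : 'I_(size f)) b : size h = size f -> size (set_nth b0 h j b) = size f.
  by move=> e; rewrite size_set_nth e; apply/maxn_idPr.
apply: (@iso_nth _ _ _ _ _ s); rewrite ?sz // => j; rewrite !nth_set_nth /=;
  rewrite !val_eqE (inj_eq perm_inj); case: eqP => // _; exact: iso_refl.
Qed.

Definition iso_invariant (T : Type) (phi : tree -> T) :=
  forall t u, iso t u -> phi t = phi u.

Lemma iso_invariant_node T (phi : tree -> T) n m (f : forest) i a :
  iso_invariant phi ->
  iso_invariant (fun u => phi (PNode n m (set_nth b0 f i (a, u)))).
Proof. by move=> inv t u tu; apply/inv/iso_set_nth. Qed.

(** The matching of the branches of two isomorphic trees reindexes the sum over
    the branches in which the operator acts. *)
Lemma ev_everywhere_iso (phi : tree -> M) L :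
  iso_invariant phi -> iso_invariant (fun t => ev phi (everywhere L t)).
Proof.
move=> inv t; elim/ptree_nested_ind: t phi inv => n m f IHf phi inv u.
case/iso_inv=> g [s [-> sz_g ea ei]].
rewrite !ev_node; congr (_ + _).
  apply: eq_ev => x.
  exact: inv (iso_modify_root x (iso_nth n m erefl sz_g ea ei)).
rewrite !ev_forest_nth sz_g [RHS](reindex_perm s).
apply: eq_bigr => i _; rewrite (IHf i (ltn_ord i) _ _ _ (ei i)).
  by apply: eq_ev => w; apply: inv; rewrite ea; apply: iso_set_nth_perm.
exact: iso_invariant_node.
Qed.

End Isomorphism.

(** * Arithmetic of multi-indices *)
Section Multis.
Variable d : nat.
Implicit Types k l m n : multi d.

Definition madd k l : multi d := [ffun i => (k i + l i)%N].
Definition msub k l : multi d := [ffun i => (k i - l i)%N].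
Definition munit (i : 'I_d.+1) : multi d := [ffun j => (j == i : nat)].
Definition mle l k : bool := [forall i, l i <= k i]%N.

(** An explicit enumeration of the finite set of all l <= a; the sum of the
    components of a is a common bound for the components of these l. *)
Definition below (a : multi d) : seq (multi d) :=
  [seq l <- [seq [ffun i => g i : nat]
              | g : {ffun 'I_d.+1 -> 'I_(\sum_i a i).+1}] | mle l a].

Lemma mem_below a l : (l \in below a) = mle l a.
Proof.
rewrite mem_filter; case: (boolP (mle l a)) => //= /forallP le_la.
have lt_l i : (l i < (\sum_i a i).+1)%N.
  by rewrite ltnS (leq_trans (le_la i)) // (bigD1 i) //= leq_addr.
apply/mapP; exists [ffun i => Ordinal (lt_l i)]; first exact: mem_enum.
by apply/ffunP => i; rewrite !ffunE.
Qed.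

Lemma below_uniq a : uniq (below a).
Proof.
apply/filter_uniq; rewrite map_inj_uniq ?enum_uniq // => g h /ffunP egh.
by apply/ffunP => i; apply: val_inj; have := egh i; rewrite !ffunE.
Qed.

Lemma to_zmultiD k l : to_zmulti (madd k l) = to_zmulti k + to_zmulti l.
Proof. by apply/ffunP => i; rewrite !ffunE PoszD. Qed.

Lemma basis_multiE i : basis_multi i = to_zmulti (munit i).
Proof. by apply/ffunP => j; rewrite !ffunE. Qed.

Lemma of_zmultiK k : of_zmulti (to_zmulti k) = Some k.
Proof.
rewrite /of_zmulti ifT; last by apply/forallP => i; rewrite ffunE.
by congr Some; apply/ffunP => i; rewrite !ffunE.
Qed.

Lemma of_zmultiB k l :
  of_zmulti (to_zmulti k - to_zmulti l) = if mle l k then Some (msub k l) else None.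
Proof.
rewrite /of_zmulti /mle.
have -> : [forall i, 0 <= (to_zmulti k - to_zmulti l) i] = [forall i, l i <= k i]%N.
  by apply: eq_forallb => i; rewrite !ffunE subr_ge0.
case: ifP => // /forallP le_lk; congr Some; apply/ffunP => i.
by rewrite !ffunE subzn.
Qed.

Lemma multi_bin_small n l : ~~ mle l n -> multi_bin n l = 0%N.
Proof.
rewrite negb_forall => /existsP[i]; rewrite -ltnNge => lt_nl.
by rewrite /multi_bin (bigD1 i) //= bin_small.
Qed.

(** Componentwise, both sides are the trinomial coefficient n! / (l! m!
    (n - l - m)!). *)
Lemma multi_bin_msub n l m :
  (multi_bin n l * multi_bin (msub n l) m)%N =
  (multi_bin n m * multi_bin (msub n m) l)%N.
Proof.
rewrite /multi_bin -!big_split /=; apply: eq_bigr => i _; rewrite !ffunE.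
move: (n i) (l i) (m i) => {}n {}l {}m.
have bin_msub x y : ('C(n, x) * 'C(n - x, y) * (x`! * y`!))%N = (n ^_ (x + y))%N.
  rewrite mulnACA !bin_ffact; elim: y => [|y IHy]; first by rewrite muln1 addn0.
  by rewrite addnS !ffactnSr mulnA IHy subnDA.
have pos : (0 < l`! * m`!)%N by rewrite muln_gt0 !fact_gt0.
by apply/eqP; rewrite -(eqn_pmul2r pos) bin_msub (mulnC l`!) bin_msub addnC.
Qed.

Lemma msubC n l m : msub (msub n l) m = msub (msub n m) l.
Proof. by apply/ffunP => i; rewrite !ffunE subnAC. Qed.

Lemma maddC k l : madd k l = madd l k.
Proof. by apply/ffunP => i; rewrite !ffunE addnC. Qed.

Lemma maddA k l m : madd k (madd l m) = madd (madd k l) m.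
Proof. by apply/ffunP => i; rewrite !ffunE addnA. Qed.

(** Pascal's rule in direction i. *)
Lemma multi_binS n i l :
  multi_bin (madd n (munit i)) l =
  (multi_bin n l + if mle (munit i) l then multi_bin n (msub l (munit i)) else 0)%N.
Proof.
have le_unit : mle (munit i) l = (0 < l i)%N.
  apply/forallP/idP => [/(_ i)|l_gt0 j]; rewrite ffunE ?eqxx //.
  by case: eqP => // ->.
rewrite le_unit /multi_bin !(bigD1 i (P := xpredT)) //=.
rewrite !ffunE eqxx addn1.
have -> : (\prod_(j < d.+1 | j != i) 'C(n j, msub l (munit i) j) =
  \prod_(j < d.+1 | j != i) 'C(n j, l j))%N.
  by apply: eq_bigr => j /negPf ji; rewrite !ffunE ji subn0.
have -> : (\prod_(j < d.+1 | j != i) 'C(madd n (munit i) j, l j) =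
  \prod_(j < d.+1 | j != i) 'C(n j, l j))%N.
  by apply: eq_bigr => j /negPf ji; rewrite !ffunE ji addn0.
case: (l i) => [|l'] /=; first by rewrite !bin0 addn0.
by rewrite binS mulnDl subn1.
Qed.

End Multis.

(** * Raising and deformed grafting as local operators *)
Section Generators.
Variables (R : comNzRingType) (d : nat).
Local Notation tree := (ptree d).
Local Notation forest := (seq (multi d * ptree d)).

Definition raise_op (i : 'I_d.+1) : local_op R d := fun n =>
  [:: (1, (madd n (munit i), [::]))].

(** Only the l <= a are listed, since a - l labels the new edge.  No condition
    l <= n is imposed on the decoration of the node: the binomial coefficient
    vanishes without it, and an index set independent of n lets the sums for two
    graftings be exchanged. *)
Definition graft_op (a : multi d) (s : tree) : local_op R d := fun n =>
  [seq ((multi_bin n l)%:R, (msub n l, [:: (msub a l, s)])) | l <- below a].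

(** Grafting along an edge of decoration in Z^(d+1), zero outside N^(d+1). *)
Definition graftz_op (a : zmulti d) (s : tree) : local_op R d :=
  if of_zmulti a is Some a' then graft_op a' s else fun=> [::].

Variable M : lmodType R.

Lemma ev_raise_op (psi : multi d * forest -> M) i n :
  ev psi (raise_op i n) = psi (madd n (munit i), [::]).
Proof. exact: ev_seq1. Qed.

Lemma ev_graft_op (psi : multi d * forest -> M) a s n :
  ev psi (graft_op a s n) =
  \sum_(l <- below a) (multi_bin n l)%:R *: psi (msub n l, [:: (msub a l, s)]).
Proof. by rewrite /ev big_map. Qed.

(** The functions of a new decoration and of a list of new branches that come from
    isomorphism-invariant functions of trees; they do not see the order of the
    new branches, nor the choice of representatives for them. *)
Definition local_invariant (psi : multi d * forest -> M) :=
  forall n f g, (forall n' m h, iso (PNode n' m (f ++ h)) (PNode n' m (g ++ h))) ->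
  psi (n, f) = psi (n, g).

Lemma local_invariant_modify (phi : tree -> M) t v : iso_invariant phi ->
  local_invariant (fun x => phi (map_at (modify_root x) t v)).
Proof.
by move=> inv n f g fg; apply/inv/iso_map_at => -[n' m h]; apply: fg.
Qed.

Lemma eq_everywhere (phi : tree -> M) L L' t : iso_invariant phi ->
  (forall psi n, local_invariant psi -> ev psi (L n) = ev psi (L' n)) ->
  ev phi (everywhere L t) = ev phi (everywhere L' t).
Proof.
move=> inv e; rewrite !ev_everywhere_nodes; apply: eq_bigr => v _; apply: e.
exact: local_invariant_modify.
Qed.

Lemma everywhereD (phi : tree -> M) L L' t :
  ev phi (everywhere (fun n => L n ++ L' n) t) =
  ev phi (everywhere L t) + ev phi (everywhere L' t).
Proof.
by rewrite !ev_everywhere_nodes -big_split; apply: eq_bigr => v _; rewrite ev_cat.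
Qed.

Lemma everywhereZ (phi : tree -> M) k L t :
  ev phi (everywhere (fun n => cscale k (L n)) t) = k *: ev phi (everywhere L t).
Proof.
rewrite !ev_everywhere_nodes scaler_sumr.
by apply: eq_bigr => v _; rewrite ev_scale.
Qed.

Lemma everywhere0 (phi : tree -> M) t : ev phi (everywhere (fun=> [::]) t) = 0.
Proof. by rewrite ev_everywhere_nodes big1 // => v _; rewrite ev_nil. Qed.

Lemma everywhere_commutator (phi : tree -> M) L L' t :
  ev (fun u => ev phi (everywhere L' u)) (everywhere L t)
  - ev (fun u => ev phi (everywhere L u)) (everywhere L' t)
  = ev phi (everywhere (then_op L L') t) + ev phi (everywhere (in_new L L') t)
  - (ev phi (everywhere (then_op L' L) t) + ev phi (everywhere (in_new L' L) t)).
Proof. by rewrite everywhere_bracket everywhereD everywhereZ !everywhereD scaleN1r. Qed.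

(** Raising attaches no branch in which to act. *)
Lemma in_new_raise (phi : tree -> M) i L t :
  ev phi (everywhere (in_new (raise_op i) L) t) = 0.
Proof.
rewrite -(everywhere0 phi t) !ev_everywhere_nodes; apply: eq_bigr => v _.
by rewrite ev_bind ev_raise_op !ev_nil.
Qed.

Lemma in_new_graft (phi : tree -> M) a s L t :
  ev phi (everywhere (in_new (graft_op a s) L) t) =
  ev (fun u => ev phi (everywhere (graft_op a u) t)) (everywhere L s).
Proof.
under [RHS]eq_ev => u do rewrite ev_everywhere_nodes.
rewrite ev_everywhere_nodes ev_sum; apply: eq_bigr => v _.
rewrite ev_bind ev_graft_op.
under [RHS]eq_ev => u do rewrite ev_graft_op.
rewrite ev_sum; apply: eq_bigr => l _.
by rewrite evZ ev_map /= ev_cat !ev_map ev_nil addr0.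
Qed.

Lemma then_raise_raise (phi : tree -> M) i j t :
  ev phi (everywhere (then_op (raise_op i) (raise_op j)) t) =
  ev phi (everywhere (then_op (raise_op j) (raise_op i)) t).
Proof.
rewrite !ev_everywhere_nodes; apply: eq_bigr => v _.
rewrite !ev_bind !ev_seq1 /=.
by rewrite -!maddA (maddC (munit i)).
Qed.

(** Reindexing by l |-> l - e_i: the l <= a with l_i > 0 correspond to all the
    indices below a - e_i, and there are none if a_i = 0. *)
Lemma below_sub_unit (F : multi d -> M) (a : multi d) i :
  \sum_(l <- below a | mle (munit i) l) F (msub l (munit i)) =
  if mle (munit i) a then \sum_(l <- below (msub a (munit i))) F l else 0.
Proof.
case: ifP => le_ia; last first.
  rewrite big_seq_cond big1 // => l; rewrite mem_below => /andP[/forallP le_la].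
  move=> /forallP le_il; case/negP: (negbT le_ia); apply/forallP => j.
  exact: leq_trans (le_il j) (le_la j).
rewrite -big_filter -(big_map (fun l => msub l (munit i)) xpredT F).
apply: perm_big; apply: uniq_perm.
- rewrite map_inj_in_uniq; first exact/filter_uniq/below_uniq.
  move=> l l'.
  rewrite !mem_filter => /andP[/forallP le_il _] /andP[/forallP le_il' _] /ffunP e.
  by apply/ffunP => j; have := e j; rewrite !ffunE => ej;
     rewrite -(subnK (le_il j)) -(subnK (le_il' j)) !ffunE ej.
- exact: below_uniq.
move=> l; rewrite mem_below; apply/mapP/forallP => [[l' + ->] j|le_l].
  rewrite mem_filter mem_below => /andP[_ /forallP le_l'].
  by rewrite !ffunE leq_sub2r // le_l'.
exists (madd l (munit i)); last by apply/ffunP => j; rewrite !ffunE addnK.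
rewrite mem_filter mem_below; apply/andP; split; apply/forallP => j.
  by rewrite [X in (_ <= X)%N]ffunE leq_addl.
have := le_l j; rewrite !ffunE => le_lj.
by move/forallP/(_ j): le_ia; rewrite ffunE => le_ia; rewrite addnC -leq_subRL.
Qed.

(** Raising first replaces C(n, l) by C(n + e_i, l) = C(n, l) + C(n, l - e_i); the
    second term is a grafting along an edge of decoration a - e_i. *)
Lemma then_raise_graft (phi : tree -> M) i a s t :
  ev phi (everywhere (then_op (raise_op i) (graft_op a s)) t) =
  ev phi (everywhere (then_op (graft_op a s) (raise_op i)) t) +
  ev phi (everywhere (graftz_op (to_zmulti a - basis_multi i) s) t).
Proof.
rewrite !ev_everywhere_nodes -big_split; apply: eq_bigr => v _ /=.
move: (node_dec t v) (fun x => phi (map_at (modify_root x) t v)) => n psi.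
rewrite !ev_bind ev_raise_op /= ev_map !ev_graft_op /=.
under [X in _ = X + _]eq_bigr => l _ do rewrite ev_seq1 /=.
under [X in X = _]eq_bigr => l _ do rewrite multi_binS natrD scalerDl.
rewrite big_split /=; congr (_ + _).
  apply: eq_bigr => l _.
  case: (boolP (mle l n)) => [/forallP le_ln|/multi_bin_small ->].
    congr (_ *: psi (_, _)); apply/ffunP => j.
    by rewrite !ffunE addnBAC ?le_ln.
  by rewrite !scale0r.
pose F l' : M :=
  (multi_bin n l')%:R *: psi (msub n l', [:: (msub (msub a (munit i)) l', s)]).
transitivity (\sum_(l <- below a | mle (munit i) l) F (msub l (munit i))).
  rewrite [RHS]big_mkcond; apply: eq_bigr => l _.
  case: ifP => [/forallP le_il|]; last by rewrite scale0r.
  congr (_ *: psi (_, [:: (_, _)])); apply/ffunP => j; rewrite !ffunE.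
    have := le_il j; rewrite !ffunE => le_ilj.
    by rewrite subnBA.
  have := le_il j; rewrite !ffunE => le_ilj.
  by rewrite -subnDA subnKC.
rewrite below_sub_unit /graftz_op basis_multiE of_zmultiB.
by case: ifP; rewrite ?ev_graft_op ?ev_nil.
Qed.

Lemma iso_swap n m (b c : multi d * tree) f :
  iso (PNode n m (b :: c :: f)) (PNode n m (c :: b :: f)).
Proof.
pose s := tperm (ord0 : 'I_(size f).+2) (fintype.lift ord0 ord0).
have sE (i : 'I_(size f).+2) :
    nth (branch0 d) (c :: b :: f) (s i) = nth (branch0 d) (b :: c :: f) i.
  rewrite /s; case: tpermP => [->|->|] //; case: i => -[|[|i]] // lt_i ne0 ne1.
    by case: ne0; apply: val_inj.
  by case: ne1; apply: val_inj.
by apply: (@iso_nth _ n m _ _ _ s) => // i; rewrite sE //; apply: iso_refl.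
Qed.

(** The two graftings differ by the order of the new branches, which isomorphism
    forgets, and by the order of the two binomial coefficients, whose product is
    symmetric. *)
Lemma then_graft_graft (phi : tree -> M) a s b r t : iso_invariant phi ->
  ev phi (everywhere (then_op (graft_op a s) (graft_op b r)) t) =
  ev phi (everywhere (then_op (graft_op b r) (graft_op a s)) t).
Proof.
move=> inv; apply: eq_everywhere => // psi n inv_psi; rewrite !ev_bind !ev_graft_op.
under eq_bigr => l _ do rewrite ev_map ev_graft_op scaler_sumr.
under [RHS]eq_bigr => l _ do rewrite ev_map ev_graft_op scaler_sumr.
rewrite exchange_big; apply: eq_bigr => l _; apply: eq_bigr => m _ /=.
rewrite !scalerA -!natrM multi_bin_msub msubC; congr (_ *: _).
by apply: inv_psi => n' m' h; apply: iso_swap.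
Qed.

Lemma graft_op_iso (phi : tree -> M) a t : iso_invariant phi ->
  iso_invariant (fun s => ev phi (everywhere (graft_op a s) t)).
Proof.
move=> inv s s' ss'; apply: eq_everywhere => // psi n inv_psi.
rewrite !ev_graft_op; apply: eq_bigr => l _; congr (_ *: _).
by apply: inv_psi => n' m' h; apply: (iso_set_nth _ _ (_ :: h) 0 _ ss').
Qed.

Lemma raise_raise (phi : tree -> M) i j t :
  ev (fun u => ev phi (everywhere (raise_op j) u)) (everywhere (raise_op i) t)
  - ev (fun u => ev phi (everywhere (raise_op i) u)) (everywhere (raise_op j) t)
  = 0.
Proof. by rewrite everywhere_commutator !in_new_raise then_raise_raise subrr. Qed.

(** Raising is a derivation of deformed grafting up to the correction term that
    the bracket with X_i accounts for. *)
Lemma raise_graft (phi : tree -> M) i a s t :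
  ev (fun u => ev phi (everywhere (graft_op a s) u)) (everywhere (raise_op i) t)
  - ev (fun u => ev phi (everywhere (raise_op i) u)) (everywhere (graft_op a s) t)
  = ev phi (everywhere (graftz_op (to_zmulti a - basis_multi i) s) t)
  - ev (fun u => ev phi (everywhere (graft_op a u) t)) (everywhere (raise_op i) s).
Proof.
rewrite everywhere_commutator then_raise_graft in_new_raise in_new_graft.
by rewrite addr0 opprD [LHS]addrACA subrr add0r.
Qed.

(** The pre-Lie identity for deformed grafting, sorted by terms that graft both
    trees on t and terms that graft one of them on the other. *)
Lemma graft_graft (phi : tree -> M) a s b r t : iso_invariant phi ->
  ev (fun u => ev phi (everywhere (graft_op b r) u)) (everywhere (graft_op a s) t)
  - ev (fun u => ev phi (everywhere (graft_op a s) u)) (everywhere (graft_op b r) t)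
  = ev (fun u => ev phi (everywhere (graft_op a u) t)) (everywhere (graft_op b r) s)
  - ev (fun u => ev phi (everywhere (graft_op b u) t)) (everywhere (graft_op a s) r).
Proof.
move=> inv; rewrite everywhere_commutator then_graft_graft // !in_new_graft.
by rewrite opprD [LHS]addrACA subrr add0r.
Qed.

End Generators.

(** * Linear maps on free modules *)
Section FreeModules.
Variables (R : nzRingType) (K : choiceType) (M : lmodType R).

Lemma fgliftE (f : K -> M) (x : {freeg K / R}) :
  fglift f x = \sum_(z <- dom x) coeff z x *: f z.
Proof. by rewrite -{1}[x]Freeg_dom fglift_Freeg /prelift big_map. Qed.

Lemma freegUZ (c : R) (z : K) : << c *g z >> = c *: << z >> :> {freeg K / R}.
Proof. by apply/eqP/freeg_eqP => y; rewrite coeffZ !coeffU mul1r. Qed.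

Lemma fglift_linear (f : K -> M) : linear (fglift f : {freeg K / R} -> M).
Proof.
have fB := lift_is_additive f.
have f0 : fglift f 0 = 0 by rewrite -[0 in LHS](subrr 0) fB subrr.
have fD x y : fglift f (x + y) = fglift f x + fglift f y.
  by rewrite -[y in LHS]opprK fB -[- y]add0r fB f0 add0r opprK.
move=> c x y; rewrite fD; congr (_ + _).
rewrite -[c *: x]/(fgscale c x) (big_morph _ fD f0) fgliftE scaler_sumr.
by apply: eq_bigr => z _; rewrite liftU scalerA.
Qed.

(** Multilinear identities can be checked on basis vectors, one argument at a
    time. *)
Lemma freeg_basis_ind (P : {freeg K / R} -> Prop) :
  (forall z, P << z >>) -> P 0 ->
  (forall c x y, P x -> P y -> P (c *: x + y)) -> forall x, P x.
Proof.
move=> PU P0 PD x; rewrite -[x]freeg_sumE.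
elim: (dom x) => [|z s IHs]; first by rewrite big_nil.
by rewrite big_cons freegUZ; apply: PD.
Qed.

End FreeModules.

Section LinearMaps.
Variables (R : comNzRingType) (M N : lmodType R) (f : M -> N).
Context (lin : linear f).

Lemma linear_map0 : f 0 = 0.
Proof. by have := lin (-1) 0 0; rewrite !scaleN1r !addNr. Qed.

Lemma linear_mapN x : f (- x) = - f x.
Proof. by rewrite -scaleN1r -[_ *: x]addr0 lin linear_map0 addr0 scaleN1r. Qed.

Lemma linear_ev T (phi : T -> M) c : f (ev phi c) = ev (fun x => f (phi x)) c.
Proof.
elim: c => [|x c IHc]; last by rewrite !ev_cons lin IHc.
by rewrite !ev_nil linear_map0.
Qed.

End LinearMaps.

(** * The post-Lie axioms *)
Section PostLieAxioms.
Variables (R : realType) (d : nat).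
Local Notation tree := (ptree d).
Local Notation forest := (seq (multi d * ptree d)).
Local Notation V := (V R d).
Local Notation br := (@bracket0 R d).
Local Notation tri := (@deformed_triangle R d).

Lemma pi_iso (t u : tree) : iso t u -> \pi_(dtree d) t = \pi_(dtree d) u.
Proof. by move=> tu; apply/(eqquotP (dtree d))/asboolP. Qed.

Lemma iso_repr (t : tree) : iso (repr (\pi_(dtree d) t)) t.
Proof. by apply/asboolP/(eqquotP (dtree d)); rewrite reprK. Qed.

Definition dtree_class (t : tree) : treeV R d := << \pi_(dtree d) t >>.

(** True at every address, since both sides pad the list of branches alike. *)
Lemma map_at_map_at (h h' : tree -> tree) t v :
  map_at h (map_at h' t v) v = map_at (h \o h') t v.
Proof.
elim: v t => [//|i v IHv] [n m f] /=.
by rewrite nth_set_nth /= eqxx /= IHv set_set_nth eqxx.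
Qed.

Lemma raiseE i (t : dtree d) :
  raise R i t = ev dtree_class (everywhere (raise_op R i) (repr t)).
Proof.
rewrite ev_everywhere_nodes; apply: eq_bigr => v _; rewrite ev_raise_op.
by rewrite /raise_at basis_multiE -to_zmultiD of_zmultiK.
Qed.

(** Both sides sum over the nodes and over indices l.  Outside the l <= a the edge
    decoration a - l is not in N^(d+1); outside the l <= n_v neither is the node
    decoration n_v - l, and the binomial coefficient vanishes. *)
Lemma deformed_graftE a (s t : dtree d) :
  deformed_graft R a s t =
  ev dtree_class (everywhere (graft_op R a (repr s)) (repr t)).
Proof.
rewrite ev_everywhere_nodes; apply: eq_bigr => v _; rewrite ev_graft_op.
move: (repr s) (repr t) => {}s {}t.
have raiseN l : raise_at v (- to_zmulti l) t =
    if mle l (node_dec t v) then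
      Some (map_at (modify_root (msub (node_dec t v) l, [::])) t v)
    else None.
  by rewrite /raise_at of_zmultiB; case: ifP.
rewrite (fsbig_seq _ _ (below_uniq a)).
transitivity (\sum_(l \in [set` below a])
    (multi_bin (node_dec t v) l)%:R *:
      tree_class R (obind (graft_at s (to_zmulti a - to_zmulti l) v)
                      (raise_at v (- to_zmulti l) t))).
  apply/esym/fsbig_widen => // l [_ /= /negP]; rewrite mem_below => nle.
  rewrite /preimage /= raiseN; case: ifP => _ /=; last by rewrite scaler0.
  by rewrite /graft_at of_zmultiB (negPf nle) scaler0.
apply: eq_fsbigr => l; rewrite inE /= mem_below => le_la; rewrite raiseN.
case: (boolP (mle l (node_dec t v))) => [_|/multi_bin_small ->]; last first.
  by rewrite !scale0r.
rewrite /= /graft_at of_zmultiB le_la /= map_at_map_at.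
congr (_ *: dtree_class (map_at _ t v)).
by apply/funext => -[].
Qed.

(** Decorations in Z^(d+1) make the bracket with X_i a plain shift, with no case
    distinction on whether the result is in N^(d+1). *)
Definition planted (z : zmulti d) (t : tree) : V := plantz R z (\pi_(dtree d) t).
Definition Xgen (i : 'I_d.+1) : V := << Xsymb i >>.

Lemma planted_iso z : iso_invariant (planted z).
Proof. by move=> t u tu; rewrite /planted (pi_iso tu). Qed.

Lemma V_ind (P : V -> Prop) :
  (forall i, P (Xgen i)) -> (forall a t, P (planted (to_zmulti a) t)) -> P 0 ->
  (forall c x y, P x -> P y -> P (c *: x + y)) -> forall x, P x.
Proof.
move=> PX Pp; apply: freeg_basis_ind => -[a t|i]; last exact: PX.
by have := Pp a (repr t); rewrite /planted /plantz of_zmultiK reprK.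
Qed.

Lemma plant_ev c (e : comb R tree) :
  plant c (ev dtree_class e) = ev (planted (to_zmulti c)) e.
Proof.
rewrite /plant (linear_ev (@fglift_linear _ _ _ _)); apply: eq_ev => t.
by rewrite /dtree_class liftU scale1r.
Qed.

Lemma bilinear_extU op x y : bilinear_ext op << x >> << y >> = op x y :> V.
Proof. by rewrite /bilinear_ext !liftU !scale1r. Qed.

Lemma bilinear_ext_bilinear op : bilinear_for *:%R *:%R (@bilinear_ext R d op).
Proof.
split=> u c x y; first exact: fglift_linear.
rewrite /bilinear_ext /= !fgliftE scaler_sumr -big_split; apply: eq_bigr => z _ /=.
by rewrite fglift_linear scalerDr !scalerA mulrC.
Qed.

Lemma bracket0_bilinear : bilinear_for *:%R *:%R br.
Proof. exact: bilinear_ext_bilinear. Qed.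

Lemma triangle_bilinear : bilinear_for *:%R *:%R tri.
Proof. exact: bilinear_ext_bilinear. Qed.

Lemma brZDl c x x' y : br (c *: x + x') y = c *: br x y + br x' y.
Proof. exact: bracket0_bilinear.1. Qed.

Lemma brZDr c x y y' : br x (c *: y + y') = c *: br x y + br x y'.
Proof. exact: bracket0_bilinear.2. Qed.

Lemma triZDl c x x' y : tri (c *: x + x') y = c *: tri x y + tri x' y.
Proof. exact: triangle_bilinear.1. Qed.

Lemma triZDr c x y y' : tri x (c *: y + y') = c *: tri x y + tri x y'.
Proof. exact: triangle_bilinear.2. Qed.

Lemma br0l y : br 0 y = 0.
Proof. exact: linear_map0 (bracket0_bilinear.1 y). Qed.

Lemma br0r x : br x 0 = 0.
Proof. exact: linear_map0 (bracket0_bilinear.2 x). Qed.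

Lemma tri0l y : tri 0 y = 0.
Proof. exact: linear_map0 (triangle_bilinear.1 y). Qed.

Lemma tri0r x : tri x 0 = 0.
Proof. exact: linear_map0 (triangle_bilinear.2 x). Qed.

Lemma brNr x y : br x (- y) = - br x y.
Proof. exact: (linear_mapN (bracket0_bilinear.2 x) y). Qed.

Lemma triNl x y : tri (- x) y = - tri x y.
Proof. exact: (linear_mapN (triangle_bilinear.1 y) x). Qed.

Lemma planted_cases z t :
  planted z t = 0 \/
  exists2 a, z = to_zmulti a & planted z t = << Planted a (\pi_(dtree d) t) >>.
Proof.
rewrite /planted /plantz /of_zmulti; case: ifP => [/forallP ge0|_]; last by left.
right; exists [ffun i => `|z i|%N] => //.
by apply/ffunP => i; rewrite !ffunE gez0_abs.
Qed.

(** If z is not in N^(d+1), then neither is z - e_i, so both sides vanish. *)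
Lemma br_planted_X z t i : br (planted z t) (Xgen i) = planted (z - basis_multi i) t.
Proof.
case: (planted_cases z t) => [p0|[a -> ->]]; last exact: bilinear_extU.
rewrite p0 br0l; case: (planted_cases (z - basis_multi i) t) => [-> //|[a e _]].
move: p0; suff -> : z = to_zmulti (madd a (munit i)).
  rewrite /planted /plantz of_zmultiK => /eqP.
  by rewrite freegU_eq0 oner_eq0.
by rewrite to_zmultiD -e -basis_multiE subrK.
Qed.

Lemma br_X_X i j : br (Xgen i) (Xgen j) = 0.
Proof. exact: bilinear_extU. Qed.

Lemma br_planted_planted z t y u : br (planted z t) (planted y u) = 0.
Proof.
case: (planted_cases z t) => [->|[a _ ->]]; first exact: br0l.
case: (planted_cases y u) => [->|[b _ ->]]; first exact: br0r.
exact: bilinear_extU.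
Qed.

(** Both sides are bilinear, so the basis suffices.  The alternating law is not
    linear in its argument, and follows from this one as 2 is invertible. *)
Lemma br_antisym x y : br x y = - br y x.
Proof.
elim/V_ind: x => [i|a t||c x x' IHx IHx']; last 2 first.
- by rewrite br0l br0r oppr0.
- by rewrite brZDl brZDr IHx IHx' scalerN opprD.
all: elim/V_ind: y => [j|b u||c y y' IHy IHy'];
  try by [rewrite br0l br0r oppr0|rewrite brZDl brZDr IHy IHy' scalerN opprD].
- by rewrite !br_X_X oppr0.
- rewrite br_planted_X /planted {1}/plantz of_zmultiK; exact: bilinear_extU.
- rewrite br_planted_X /planted {2}/plantz of_zmultiK.
  by rewrite [br (Xgen j) _]bilinear_extU opprK.
- by rewrite !br_planted_planted oppr0.
Qed.

Lemma br_X_planted z t i : br (Xgen i) (planted z t) = - planted (z - basis_multi i) t.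
Proof. by rewrite br_antisym br_planted_X. Qed.

Lemma br_alternating x : br x x = 0.
Proof.
have /eqP := br_antisym x x; rewrite -addr_eq0 -mulr2n -scaler_nat scaler_eq0.
by rewrite pnatr_eq0 => /eqP.
Qed.

Lemma tri_X x i : tri x (Xgen i) = 0.
Proof.
elim/V_ind: x => [j|a t||c x x' IHx IHx'].
- exact: bilinear_extU.
- by rewrite /planted /plantz of_zmultiK; apply: bilinear_extU.
- exact: tri0l.
- by rewrite triZDl IHx IHx' scaler0 addr0.
Qed.

Lemma tri_X_planted i z t :
  tri (Xgen i) (planted z t) = ev (planted z) (everywhere (raise_op R i) t).
Proof.
rewrite -(ev_everywhere_iso _ (planted_iso z) (iso_repr t)).
rewrite /planted /plantz; case zE: (of_zmulti z) => [a|]; last first.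
  by rewrite tri0r /ev big1 // => x _; rewrite scaler0.
rewrite /deformed_triangle bilinear_extU /= raiseE plant_ev; apply: eq_ev => u.
by rewrite /planted /plantz of_zmultiK.
Qed.

Lemma tri_planted_planted y s z t :
  tri (planted y s) (planted z t) =
  ev (planted z) (everywhere (graftz_op R y s) t).
Proof.
rewrite /graftz_op {1}/planted {1}/plantz.
case: (of_zmulti y) => [a|]; last by rewrite tri0l everywhere0.
rewrite -(ev_everywhere_iso _ (planted_iso z) (iso_repr t)).
rewrite -(graft_op_iso _ _ (planted_iso z) (iso_repr s)).
rewrite /planted /plantz; case zE: (of_zmulti z) => [b|]; last first.
  by rewrite tri0r /ev big1 // => x _; rewrite scaler0.
rewrite /deformed_triangle bilinear_extU /= deformed_graftE plant_ev.
apply: eq_ev => u.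
by rewrite /planted /plantz of_zmultiK.
Qed.

Lemma br_evl T (phi : T -> V) c y : br (ev phi c) y = ev (fun x => br (phi x) y) c.
Proof. exact: (linear_ev (bracket0_bilinear.1 y)). Qed.

Lemma tri_evl T (phi : T -> V) c y : tri (ev phi c) y = ev (fun x => tri (phi x) y) c.
Proof. exact: (linear_ev (triangle_bilinear.1 y)). Qed.

Lemma tri_evr T (phi : T -> V) c x : tri x (ev phi c) = ev (fun y => tri x (phi y)) c.
Proof. exact: (linear_ev (triangle_bilinear.2 x)). Qed.

Lemma tri_planted_plantedE a s z t :
  tri (planted (to_zmulti a) s) (planted z t) =
  ev (planted z) (everywhere (graft_op R a s) t).
Proof. by rewrite tri_planted_planted /graftz_op of_zmultiK. Qed.

Lemma br_evr T (phi : T -> V) c x : br x (ev phi c) = ev (fun y => br x (phi y)) c.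
Proof. exact: (linear_ev (bracket0_bilinear.2 x)). Qed.

(** Double brackets vanish unless exactly one entry is a planted tree, and then
    the identity says that the shifts of its decoration by -e_i and -e_j
    commute. *)
Lemma bracket0_jacobi x y z : br x (br y z) + br y (br z x) + br z (br x y) = 0.
Proof.
have lin_step c (a1 a2 b1 b2 c1 c2 : V) :
    a1 + b1 + c1 = 0 -> a2 + b2 + c2 = 0 ->
    (c *: a1 + a2) + (c *: b1 + b2) + (c *: c1 + c2) = 0.
  move=> e1 e2.
  rewrite [X in X + _]addrACA [LHS]addrACA -!scalerDr e1 e2.
  by rewrite scaler0 addr0.
elim/V_ind: x => [i|a t||k x x' IHx IHx']; last 2 first.
- by rewrite !(br0l, br0r) !addr0.
- by rewrite !(brZDl, brZDr) lin_step.
all: elim/V_ind: y => [j|b u||k y y' IHy IHy'];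
  try by [rewrite !(br0l, br0r) !addr0 | rewrite !(brZDl, brZDr) lin_step].
all: elim/V_ind: z => [l|c w||k z z' IHz IHz'];
  try by [rewrite !(br0l, br0r) !addr0 | rewrite !(brZDl, brZDr) lin_step].
all: rewrite ?(br_X_X, br_X_planted, br_planted_X, br_planted_planted, brNr).
all: rewrite ?(br_X_X, br_X_planted, br_planted_X, br_planted_planted, brNr).
all: rewrite ?(br0r, oppr0, add0r, addr0) //.
all: by rewrite [_ - basis_multi _ - basis_multi _]addrAC ?opprK ?subrr ?addNr.
Qed.

Lemma triangle_derivation x y z : tri x (br y z) = br (tri x y) z + br y (tri x z).
Proof.
have lin_step c (a1 a2 b1 b2 c1 c2 : V) : a1 = b1 + c1 -> a2 = b2 + c2 ->
    c *: a1 + a2 = (c *: b1 + b2) + (c *: c1 + c2).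
  by move=> -> ->; rewrite scalerDr addrACA.
(* The product acts above the trunk, by a combination that does not depend on
   the decoration c of the trunk; the bracket only changes c. *)
have tri_planted t : exists E, forall c, tri x (planted c t) = ev (planted c) E.
  elim/V_ind: x => [i|a s||k x x' [E IHx] [E' IHx']].
  - by exists (everywhere (raise_op R i) t) => c; apply: tri_X_planted.
  - by exists (everywhere (graft_op R a s) t) => c; apply: tri_planted_plantedE.
  - by exists [::] => c; rewrite tri0l ev_nil.
  - exists (cscale k E ++ E') => c; rewrite triZDl IHx IHx'.
    by rewrite ev_cat ev_scale.
elim/V_ind: y => [j|b u||k y y' IHy IHy']; last 2 first.
- by rewrite !(br0l, tri0r) !addr0.
- by rewrite !(brZDl, triZDr); apply: lin_step.
all: elim/V_ind: z => [l|c w||k z z' IHz IHz'];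
  try by [rewrite !(br0r, tri0r) !addr0 | rewrite !(brZDr, triZDr); apply: lin_step].
- by rewrite br_X_X !tri_X br0l br0r tri0r addr0.
- have [E triE] := tri_planted w.
  rewrite br_X_planted tri_X br0l add0r -scaleN1r -[_ *: _]addr0 triZDr tri0r.
  rewrite !triE br_evr addr0 -evZ; apply: eq_ev => v.
  by rewrite br_X_planted scaleN1r.
- have [E triE] := tri_planted u.
  rewrite br_planted_X tri_X br0r addr0 !triE br_evl; apply: eq_ev => v.
  by rewrite br_planted_X.
- have [E triE] := tri_planted u; have [E' triE'] := tri_planted w.
  rewrite br_planted_planted tri0r triE triE' br_evl br_evr.
  by rewrite /ev !big1 ?addr0 // => v _; rewrite br_planted_planted scaler0.
Qed.

Lemma associatorDl c x x' y z :
  associator tri (c *: x + x') y z = c *: associator tri x y z + associator tri x' y z.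
Proof. by rewrite /associator !triZDl scalerBr opprD addrACA. Qed.

Lemma associatorDm c x y y' z :
  associator tri x (c *: y + y') z = c *: associator tri x y z + associator tri x y' z.
Proof. by rewrite /associator triZDr !triZDl triZDr scalerBr opprD addrACA. Qed.

Lemma associatorDr c x y z z' :
  associator tri x y (c *: z + z') = c *: associator tri x y z + associator tri x y z'.
Proof. by rewrite /associator !triZDr scalerBr opprD addrACA. Qed.

Lemma associator0l y z : associator tri 0 y z = 0.
Proof. by rewrite /associator !tri0l subrr. Qed.

Lemma associator0m x z : associator tri x 0 z = 0.
Proof. by rewrite /associator tri0l !tri0r tri0l subrr. Qed.

Lemma associator_X x y i : associator tri x y (Xgen i) = 0.
Proof. by rewrite /associator !tri_X tri0r subrr. Qed.

Lemma associator_X_X i j c t :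
  associator tri (Xgen i) (Xgen j) (planted c t) =
  ev (fun u => ev (planted c) (everywhere (raise_op R i) u))
     (everywhere (raise_op R j) t).
Proof.
rewrite /associator tri_X tri0l subr0 tri_X_planted tri_evr.
by apply: eq_ev => u; rewrite tri_X_planted.
Qed.

Lemma associator_planted_X a s i c t :
  associator tri (planted (to_zmulti a) s) (Xgen i) (planted c t) =
  ev (fun u => ev (planted c) (everywhere (graft_op R a s) u))
     (everywhere (raise_op R i) t).
Proof.
rewrite /associator tri_X tri0l subr0 tri_X_planted tri_evr.
by apply: eq_ev => u; rewrite tri_planted_plantedE.
Qed.

Lemma associator_X_planted a s i c t :
  associator tri (Xgen i) (planted (to_zmulti a) s) (planted c t) =
  ev (fun u => ev (planted c) (everywhere (raise_op R i) u))
     (everywhere (graft_op R a s) t)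
  - ev (fun u => ev (planted c) (everywhere (graft_op R a u) t))
     (everywhere (raise_op R i) s).
Proof.
rewrite /associator tri_planted_plantedE tri_evr tri_X_planted tri_evl.
by congr (_ - _); apply: eq_ev => u; rewrite ?tri_X_planted ?tri_planted_plantedE.
Qed.

Lemma associator_planted_planted a s b r c t :
  associator tri (planted (to_zmulti a) s) (planted (to_zmulti b) r)
    (planted c t) =
  ev (fun u => ev (planted c) (everywhere (graft_op R a s) u))
     (everywhere (graft_op R b r) t)
  - ev (fun u => ev (planted c) (everywhere (graft_op R b u) t))
     (everywhere (graft_op R a s) r).
Proof.
rewrite /associator !tri_planted_plantedE tri_evr tri_evl.
by congr (_ - _); apply: eq_ev => u; rewrite !tri_planted_plantedE.
Qed.

(** On basis vectors, the three commutator formulas [raise_raise], [raise_graft]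
    and [graft_graft]. *)
Lemma triangle_associator x y z :
  tri (br x y) z = associator tri x y z - associator tri y x z.
Proof.
have lin_step c (a1 a2 b1 b2 d1 d2 : V) : a1 = b1 - d1 -> a2 = b2 - d2 ->
    c *: a1 + a2 = (c *: b1 + b2) - (c *: d1 + d2).
  by move=> -> ->; rewrite scalerBr opprD addrACA.
elim/V_ind: z => [l|c t||k z z' IHz IHz']; last 2 first.
- by rewrite !tri0r /associator !tri0r !subrr.
- by rewrite triZDr !associatorDr; apply: lin_step.
- by rewrite tri_X !associator_X subrr.
elim/V_ind: x => [i|a s||k x x' IHx IHx']; last 2 first.
- by rewrite br0l tri0l associator0l associator0m subrr.
- by rewrite brZDl triZDl associatorDl associatorDm; apply: lin_step.
all: elim/V_ind: y => [j|b r||k y y' IHy IHy'];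
  try by [rewrite br0r tri0l associator0l associator0m subrr
    |rewrite brZDr triZDl associatorDl associatorDm; apply: lin_step].
- by rewrite br_X_X tri0l !associator_X_X raise_raise.
- rewrite br_X_planted triNl tri_planted_planted.
  rewrite associator_X_planted associator_planted_X.
  have /eqP := raise_graft (planted (to_zmulti c)) i b r t.
  rewrite subr_eq => /eqP ->; set Z := ev _ _; set B := ev _ _; set W := ev _ _.
  by rewrite -(addrA Z) (addrC (- W)) opprD [RHS]addrCA subrr addr0.
- rewrite br_planted_X tri_planted_planted.
  rewrite associator_X_planted associator_planted_X.
  have /eqP := raise_graft (planted (to_zmulti c)) j a s t.
  rewrite subr_eq => /eqP ->; set Z := ev _ _; set W := ev _ _.
  by rewrite -(addrA Z) (addrC (- W)) addrK.
rewrite br_planted_planted tri0l !associator_planted_planted.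
have /eqP := graft_graft a s b r t (planted_iso (to_zmulti c)).
rewrite subr_eq => /eqP ->.
set A := ev _ _; set D := ev _ _; set C := ev _ _.
by rewrite (addrAC _ A) (addrC C) addrK (addrC (- D)) subrr.
Qed.

End PostLieAxioms.

Theorem theorem4p4 (R : realType) (d : nat) :
  @is_post_lie R (V R d) (@bracket0 R d) (@deformed_triangle R d).
Proof.
split; [split | | |].
- exact: bracket0_bilinear.
- exact: br_alternating.
- exact: bracket0_jacobi.
- exact: triangle_bilinear.
- exact: triangle_derivation.
- exact: triangle_associator.
Qed.
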